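(* Let $r\ge 2$, $1\le d\le r-1$ and $1\le h\le d-1$ be integers with $(h+1)\mid dn$. Let $U_1\subseteq\mathbb{F}_{q^n}^d$ be an $\mathbb{F}_q$-subspace such that $L_{U_1}$ is a properly maximum $h$-scattered $\mathbb{F}_q$-linear set in $\mathrm{PG}(d-1,q^n)$. Consider $\mathrm{PG}(r,q^n)=\mathrm{PG}(\mathbb{F}_{q^n}^{r+1},\mathbb{F}_{q^n})$ with hyperplane $\pi_\infty=\{x_r=0\}\cong\mathrm{PG}(r-1,q^n)$, and let $$U=\{(x_0,\ldots,x_{r})\in\mathbb{F}_{q^n}^{r+1}:(x_0,\ldots,x_{d-1})\in U_1,\ x_r=0\}.$$ Let $Q=\langle y\rangle_{\mathbb{F}_{q^n}}$ be a point of $\mathrm{PG}(r,q^n)\setminus\pi_\infty$, let $U'=U\oplus\langle y\rangle_{\mathbb{F}_q}$ and $\mathcal{B}=L_{U'}$. Then $$|\mathcal{B}|=q^{n(r-d)}\left[\tfrac{dn}{h+1}+1\right]_q+[r-d]_{q^n},$$ and the set of values $|\pi\cap\mathcal{B}|$, as $\pi$ ranges over all hyperplanes of $\mathrm{PG}(r,q^n)$, is exactly $$\left\{q^{n(r-d)}\left[\tfrac{dn}{h+1}\right]_q+[r-d]_{q^n},\ \ q^{n(r-d-1)}\left[\tfrac{dn}{h+1}+1\right]_q+[r-d-1]_{q^n}\right\}\cup\left\{q^{n(r-d)}\left([\gamma_i]_q+\beta_{i,j}\right)+[r-d]_{q^n}: i\in\{0,\ldots,h\},\ j\in\{0,1\}\right\},$$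 where $\gamma_i=\frac{dn}{h+1}-n+i$, and $\beta_{i,j}=0$ if $j=0$ and $i\ge1$, while $\beta_{i,j}=q^{\gamma_i}$ otherwise.
   Context: For an $\mathbb{F}_q$-subspace $U$ of $\mathbb{F}_{q^n}^m$, the $\mathbb{F}_q$-linear set $L_U=\{\langle u\rangle_{\mathbb{F}_{q^n}}:u\in U\setminus\{0\}\}\subseteq\mathrm{PG}(m-1,q^n)$ has rank $\dim_{\mathbb{F}_q}U$; the weight of a projective subspace $\mathrm{PG}(W,\mathbb{F}_{q^n})$ in $L_U$ is $\dim_{\mathbb{F}_q}(U\cap W)$. $[k]_q=\frac{q^k-1}{q-1}$. An $\mathbb{F}_q$-linear set of $\mathrm{PG}(d-1,q^n)$ is $h$-scattered ($1\le h\le d-1$) if it spans $\mathrm{PG}(d-1,q^n)$ and every $(h-1)$-dimensional projective subspace has weight at most $h$ in it; it is properly maximum $h$-scattered if moreover its rank equals $\frac{dn}{h+1}$. Here $L_U\subseteq\pi_\infty$ is the cone with base $L_{U_1}$ (in the $(d-1)$-space $x_d=\dots=x_r=0$) and vertex the $(r-d-1)$-space $S_2=\{x_0=\dots=x_{d-1}=0=x_r\}$. *)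

(* Defs.v *)
From HB Require Import structures.
From mathcomp Require Import all_boot all_order all_algebra all_field.
From mathcomp Require Import mathcomp_extra boolp classical_sets cardinality.
Set Implicit Arguments.
Unset Strict Implicit.
Unset Printing Implicit Defensive.
Import GRing.Theory.
Local Open Scope ring_scope.
Local Open Scope classical_set_scope.

(* With [F] = F_q and [L] = F_{q^n}, both types below are F_{q^n}^m, with
   convertible carriers: [{vspace vecF L m}] is the type of F_q-subspaces,
   [{vspace vecL L m}] that of F_{q^n}-subspaces, i.e. of the projective
   subspaces of PG(m-1, q^n). *)
Notation vecF L m := {ffun 'I_m -> L}.
Notation vecL L m := {ffun 'I_m -> L^o}.

Section LinearSets.
Variables (F : finFieldType) (L : fieldExtType F).

Section Dim.
Variable m : nat.
Implicit Types (U : {vspace vecF L m}) (W : {vspace vecL L m}).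

Definition scalev (a : L) (v : vecF L m) : vecF L m := [ffun i => a * v i].

(* Restriction of scalars: [W] as an F_q-subspace; see [mem_resF]. *)
Definition resF W : {vspace vecF L m} :=
  <<[seq scalev a w | a <- (vbasis {:L}%VS : seq L),
                      w <- (vbasis W : seq (vecF L m))]>>%VS.

Lemma scalevE (a : L) (v : vecL L m) : scalev a v = a *: v.
Proof. by apply/ffunP=> i; rewrite !ffunE. Qed.

Lemma scaleFE (a : F) (v : vecF L m) : a *: v = scalev a%:A v.
Proof. by apply/ffunP=> i; rewrite !ffunE -scalerAl mul1r. Qed.

Lemma mem_resF W (v : vecF L m) : (v \in resF W) = ((v : vecL L m) \in W).
Proof.
pose X := [seq scalev a w | a <- (vbasis {:L}%VS : seq L),
                            w <- (vbasis W : seq (vecF L m))].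
apply/idP/idP => vW.
  rewrite (@coord_span _ _ _ (in_tuple X) v vW).
  apply: (@big_ind _ (fun x : vecF L m => (x : vecL L m) \in W)) => [|x z|i _].
  - exact: mem0v.
  - exact: memvD.
  rewrite scaleFE scalevE; apply: memvZ.
  have /allpairsP[[a w] /= [_ wW ->]] : (in_tuple X)`_i \in X by exact: mem_nth.
  by rewrite scalevE memvZ // vbasis_mem.
rewrite (coord_vbasis vW).
apply: (@big_ind _ (fun x : vecL L m => (x : vecF L m) \in resF W))
  => [|x y|i _].
- exact: mem0v.
- exact: memvD.
rewrite -scalevE (coord_vbasis (memvf (coord (vbasis W) i v : L))).
set w := (vbasis W)`_i.
rewrite (_ : scalev _ _ = \sum_j coord (vbasis {:L}%VS) j (coord (vbasis W) i v)
    *: scalev (vbasis {:L}%VS)`_j w); last first.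
  apply/ffunP=> k; rewrite ffunE sum_ffunE big_distrl /=.
  by apply: eq_bigr => j _; rewrite !ffunE scalerAl.
apply: memv_suml => j _; apply/memvZ/memv_span/allpairsP.
exists ((vbasis {:L}%VS)`_j, w); split => //.
  by apply: mem_nth; rewrite size_tuple.
by apply: mem_nth; rewrite size_tuple.
Qed.

Definition weight U W : nat := \dim (U :&: resF W).

Definition linset U : set {vspace vecL L m} :=
  [set P | exists u : vecF L m,
      [/\ u \in U, u != 0 & P = <[u : vecL L m]>%VS]].

Definition spanning U : Prop :=
  forall W, (forall P, linset U P -> (P <= W)%VS) -> W = fullv.

(* [\dim W] is the vector-space dimension over F_{q^n}: [\dim W = h] means that
   PG(W) has projective dimension h - 1. *)
Definition scattered (h : nat) U : Prop :=
  spanning U /\ forall W, \dim W = h -> (weight U W <= h)%N.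

(* The rank is m n / (h + 1), stated without division. *)
Definition prop_max_scattered (h : nat) U : Prop :=
  scattered h U /\ (\dim U * h.+1 = m * \dim {:L})%N.
End Dim.

Section Cone.
Variables r d : nat.

(* (x_0, ..., x_r) |-> (x_0, ..., x_{d-1}), meaningful for d <= r + 1 only, as
   [inord i] is a default index when i > r. *)
Definition firstcoords (x : vecF L r.+1) : vecF L d := [ffun i : 'I_d => x (inord i)].
Definition lastcoordF (x : vecF L r.+1) : L := x ord_max.
Definition lastcoordL (x : vecL L r.+1) : L^o := x ord_max.

Fact firstcoords_linear : linear firstcoords.
Proof. by move=> a x y; apply/ffunP=> i; rewrite !ffunE. Qed.
HB.instance Definition _ :=
  GRing.isLinear.Build F _ _ _ firstcoords firstcoords_linear.

Fact lastcoordF_linear : linear lastcoordF.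
Proof. by move=> a x y; rewrite /lastcoordF !ffunE. Qed.
HB.instance Definition _ :=
  GRing.isLinear.Build F _ _ _ lastcoordF lastcoordF_linear.

Fact lastcoordL_linear : linear lastcoordL.
Proof. by move=> a x y; rewrite /lastcoordL !ffunE. Qed.
HB.instance Definition _ :=
  GRing.isLinear.Build L _ _ _ lastcoordL lastcoordL_linear.

Definition pi_infty : {vspace vecL L r.+1} := lker (linfun lastcoordL).

Lemma mem_pi_infty (x : vecL L r.+1) : (x \in pi_infty) = (x ord_max == 0).
Proof. by rewrite memv_ker lfunE. Qed.

Definition cone (U1 : {vspace vecF L d}) : {vspace vecF L r.+1} :=
  (linfun firstcoords @^-1: U1 :&: lker (linfun lastcoordF))%VS.

Lemma mem_cone U1 (x : vecF L r.+1) :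
  (x \in cone U1) = ([ffun i : 'I_d => x (inord i)] \in U1) && (x ord_max == 0).
Proof. by rewrite memv_cap memv_ker -memv_preim !lfunE. Qed.
End Cone.
End LinearSets.

(* The division is exact for q >= 2. *)
Definition gauss (q k : nat) : nat := ((q ^ k - 1) %/ (q - 1))%N.

(* Main.v *)
Require Import Defs.
From HB Require Import structures.
From mathcomp Require Import all_boot all_order all_algebra all_field.
From mathcomp Require Import mathcomp_extra boolp classical_sets cardinality.
From mathcomp Require Import zify.
Set Implicit Arguments.
Unset Strict Implicit.
Unset Printing Implicit Defensive.
Import GRing.Theory.
Local Open Scope ring_scope.

(** If [U1] is [h]-scattered of rank
    [N = dn/(h+1)], then any [h+1] F_q-independent vectors of [U1] are
    F_{q^n}-independent, so for F_q-independent scalars [c_0, ..., c_h] the sum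
    [c_0 U1 + ... + c_h U1] is direct and, by dimension, all of F_{q^n}^d.

    Let [a <> 0] be a linear form with image [T = a(U1)] in F_{q^n}.  If
    [dim T < n - h], there are [h+1] independent scalars [c] with [c T] inside a
    fixed F_q-hyperplane of F_{q^n}, and then so is [a(F_{q^n}^d)], which is
    absurd.  Hence every hyperplane of PG(d-1, q^n) has weight [N - n + i] with
    [0 <= i <= h].  All [i] occur: the forms mapping [U1] into a subspace [S] of
    codimension [i <= h + 1] make up a space of dimension exactly [N(h+1-i)], and
    for [i <= h] the ones whose image is smaller than [S] are covered by fewer
    than [q^n <= q^N] such spaces attached to hyperplanes of [S].

    In [U'] only the points of the vertex have weight [n], all others have
    weight 1.  So a section [pi] of [B] is counted by the dimensions of
    [U' :&: pi] and of its intersection with the vertex, and these follow from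
    the image of [U'] under the linear form defining [pi]. *)

(** * Subspaces cut out by linear conditions *)

Section Subspaces.
Variables (K : fieldType) (vT : vectType K).
Implicit Types U W : {vspace vT}.

Lemma memv_notin U W : (\dim W < \dim U)%N -> exists2 v, v \in U & v \notin W.
Proof.
move=> lt_WU; apply/subvPn; apply: contraL lt_WU => /dimvS.
by rewrite -leqNgt.
Qed.

Lemma dimv_add_line U v : v \notin U -> \dim (U + <[v]>) = (\dim U).+1.
Proof.
move=> vU; have v0 : v != 0 by apply: contraNneq vU => ->; rewrite mem0v.
rewrite dimv_disjoint_sum ?dim_vline ?v0 ?addn1 //.
apply/eqP; rewrite -subv0; apply/subvP => w /memv_capP[wU /vlineP[k wE]].
rewrite memv0; apply: contraNT vU => w0.
have k0 : k != 0 by apply: contraNneq w0 => k0; rewrite wE k0 scale0r.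
by rewrite -[v](scalerK k0) -wE memvZ.
Qed.

Lemma exists_subv_between U W m : (U <= W)%VS -> (\dim U <= m <= \dim W)%N ->
  exists X : {vspace vT}, [/\ (U <= X)%VS, (X <= W)%VS & \dim X = m].
Proof.
move=> sUW /andP[leU leW]; rewrite -(subnKC leU) in leW *.
elim: (m - \dim U)%N leW => [|j IHj] leW.
  by exists U; rewrite subvv addn0.
have [|X [UX XW dX]] := IHj; first by lia.
have [|v vW vX] := @memv_notin W X; first by lia.
exists (X + <[v]>)%VS; split; first exact: subv_trans UX (addvSl _ _).
  by rewrite subv_add XW -memvE.
by rewrite dimv_add_line // dX addnS.
Qed.

End Subspaces.

Section Conditions.
Variables (K : fieldType) (vT wT : vectType K).
Implicit Types (A : {vspace vT}) (S : {vspace wT}).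

(** Rank-nullity: [g] has the same kernel on [A] and on [A :&: g @^-1: S], and the image loses at
    most the codimension of [S] in [S0]. *)
Lemma dimv_preim_ge (g : 'Hom(vT, wT)) A S S0 :
    (S <= S0)%VS -> (g @: A <= S0)%VS ->
  (\dim A <= \dim (A :&: g @^-1: S) + (\dim S0 - \dim S))%N.
Proof.
move=> sS sA; rewrite -(limg_ker_dim g A) -(limg_ker_dim g (A :&: g @^-1: S)).
have -> : (A :&: g @^-1: S :&: lker g = A :&: lker g)%VS.
  apply/vspaceP => x; rewrite !memv_cap -memv_preim memv_ker -andbA.
  by case: eqP => [->|_]; rewrite ?andbF // mem0v.
have -> : (g @: (A :&: g @^-1: S) = g @: A :&: S)%VS.
  apply/vspaceP => x; rewrite memv_cap; apply/memv_imgP/andP.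
    case=> y; rewrite memv_cap -memv_preim => /andP[yA yS] ->.
    by rewrite memv_img.
  case=> /memv_imgP[y yA ->] yS; exists y => //.
  by rewrite memv_cap yA -memv_preim.
have := dimv_sum_cap (g @: A) S.
have : (\dim (g @: A + S) <= \dim S0)%N by apply: dimvS; rewrite subv_add sA.
have := dimvS sS; lia.
Qed.

Lemma dimv_bigcap_preim_ge (gs : seq 'Hom(vT, wT)) A S S0 :
    (S <= S0)%VS -> (forall g, g \in gs -> (g @: A <= S0)%VS) ->
  (\dim A <= \dim (A :&: \bigcap_(g <- gs) (g @^-1: S))
             + size gs * (\dim S0 - \dim S))%N.
Proof.
move=> sS; elim: gs A => [|g gs IH] A sA; first by rewrite big_nil capvf addn0.
rewrite big_cons capvA mulSn.
have sA' f : f \in gs -> (f @: (A :&: g @^-1: S) <= S0)%VS.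
  move=> fgs; apply: subv_trans (limgS f (capvSl _ _)) _.
  by apply: sA; rewrite inE fgs orbT.
apply: leq_trans (dimv_preim_ge sS (sA _ (mem_head _ _))) _.
by rewrite addnA addnAC leq_add2r; apply: IH.
Qed.

Variables (uT : vectType K) (B : uT -> 'Hom(vT, wT)).
Implicit Type T : {vspace uT}.
Hypothesis B_linear : forall v, linear (B^~ v).

(* For the pairing (v, u) |-> B u v: the vectors v with B(T, v) in S. *)
Definition colon (S : {vspace wT}) (T : {vspace uT}) : {vspace vT} :=
  (\bigcap_(g <- [seq B e | e <- vbasis T]) (g @^-1: S))%VS.

(** The definition tests only a basis of [T]; linearity in [u] extends the condition to all of
    [T]. *)
Lemma mem_colonP S T v :
  reflect (forall u, u \in T -> B u v \in S) (v \in colon S T).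
Proof.
apply: (iffP idP) => [vC u Tu|vP].
  pose BL : {linear uT -> wT} := HB.pack (B^~ v)
     (GRing.isLinear.Build _ _ _ _ (B^~ v) (B_linear v)).
  have -> : B u v = BL u by [].
  rewrite (coord_vbasis Tu) linear_sum; apply: memv_suml => i _.
  rewrite linearZ; apply: memvZ; rewrite /= memv_preim.
  have eT : (vbasis T)`_i \in vbasis T by rewrite mem_nth ?size_tuple.
  move: vC; rewrite /colon big_map memvE => /subv_trans; apply.
  by rewrite (big_rem _ eT) /= capvSl.
have : {subset (vbasis T : seq uT) <= T} by move=> e; apply: vbasis_mem.
rewrite /colon big_map memvE.
elim: (tval (vbasis T)) => [|e s IH] sT.
  by rewrite big_nil subvf.
rewrite big_cons subv_cap -memvE -memv_preim vP ?sT ?mem_head //=.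
by apply: IH => x xs; apply: sT; rewrite inE xs orbT.
Qed.

(** Each basis vector of [T] imposes at most [\dim S0 - \dim S] conditions on [A]. *)
Lemma dimv_colon_ge A S S0 T :
    (S <= S0)%VS -> (forall u, u \in T -> (B u @: A <= S0)%VS) ->
  (\dim A <= \dim (A :&: colon S T) + \dim T * (\dim S0 - \dim S))%N.
Proof.
move=> sS sA.
have <- : size [seq B e | e <- vbasis T] = \dim T by rewrite size_map size_tuple.
apply: dimv_bigcap_preim_ge => // _ /mapP[e eT ->]; apply: sA.
exact: vbasis_mem eT.
Qed.

Lemma dimv_colonf_ge S T :
  (\dim {:vT} <= \dim (colon S T) + \dim T * (\dim {:wT} - \dim S))%N.
Proof.
have := @dimv_colon_ge {:vT} S {:wT} T (subvf _) (fun u _ => subvf _).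
by rewrite capfv.
Qed.

End Conditions.

(** * Images of a scattered subspace under linear forms *)

(* Identifies the convertible but syntactically different terms [\dim U] that
   come from distinct inheritance paths, which [lia] takes for distinct atoms. *)
Ltac dimlia :=
  repeat match goal with |- context [@dimv ?K ?V ?U] =>
    let x := fresh "x" in
    set (x := @dimv K V U);
    repeat match goal with |- context [@dimv ?K' ?V' ?U'] =>
      change (@dimv K' V' U') with x end;
    clearbody x
  end; lia.

(** * Coverings of a space over a finite field by subspaces *)

Section VspaceCard.
Variable F : finFieldType.

Lemma card_vspace_pred (vT : vectType F) (U : {vspace vT}) :
  #|[pred x : finvect_type vT | (x : vT) \in U]| = (#|F| ^ \dim U)%N.
Proof.
case: vT U => T cT U; pose vT := Vector.Pack cT.
rewrite -(@card_vspace F (finvect_type vT : finType) cT U).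
by apply: eq_card => x; rewrite inE.
Qed.

(** Counting vectors: since [P] misses 0, fewer than q^(dim wT) indices occur, and each covers at
    most q^m vectors. *)
Lemma dimv_cover_lt (vT wT : vectType F) (A : {vspace vT}) (P : pred wT)
    (B : wT -> {vspace vT}) m :
    ~~ P 0 -> (forall a, a \in A -> exists2 c, P c & a \in B c) ->
    (forall c, P c -> (\dim (B c) <= m)%N) ->
  (\dim A < \dim {:wT} + m)%N.
Proof.
move=> P0 cover leB; have q1 : (1 < #|F|)%N := finNzRing_gt1 F.
pose E (U : {vspace vT}) := [set x : finvect_type vT | (x : vT) \in U].
have cardE U : #|E U| = (#|F| ^ \dim U)%N by rewrite cardsE card_vspace_pred.
pose Q : pred (finvect_type wT) := P.
have ltQ : (#|Q| < #|F| ^ \dim {:wT})%N.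
  rewrite -card_vspace_pred; apply: proper_card; apply/properP.
  split; first by apply/fintype.subsetP => c _; rewrite !inE memvf.
  by exists 0; rewrite ?inE ?mem0v.
rewrite -(ltn_exp2l _ _ q1) -cardE expnD.
have subE : E A \subset \bigcup_(c | Q c) E (B c).
  apply/fintype.subsetP => a; rewrite inE => /cover[c Pc ac].
  by apply/finset.bigcupP; exists c => //; rewrite inE.
apply: leq_ltn_trans (subset_leq_card subE) _.
apply: (@leq_ltn_trans (#|Q| * #|F| ^ m)%N); last first.
  by rewrite ltn_pmul2r ?expn_gt0 ?(ltnW q1).
rewrite -sum_nat_const; elim/big_rec2: _ => [|c X x Qc leX].
  by rewrite cards0.
apply: leq_trans (leq_card_setU _ _) _; apply: leq_add => //.
by rewrite cardE leq_exp2l // leB.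
Qed.
End VspaceCard.

Section Scattered.
Variables (F : finFieldType) (L : fieldExtType F).
Local Notation n := (\dim {:L}%VS).

(** * Linear forms, and independence over F_{q^n} in scattered subspaces *)

Section Dot.
Variable m : nat.
Implicit Types (U : {vspace vecF L m}) (W : {vspace vecL L m}).

Fact scalev_linear (c : L) : linear (@scalev F L m c).
Proof.
by move=> k x y; apply/ffunP => i; rewrite !ffunE mulrDr scalerAr.
Qed.
HB.instance Definition _ c :=
  GRing.isLinear.Build F _ _ _ (@scalev F L m c) (scalev_linear c).

Definition dot (a x : vecF L m) : L := \sum_i a i * x i.

Fact dot_linear a : linear (dot a).
Proof.
move=> k x y; rewrite /dot scaler_sumr -big_split; apply: eq_bigr => i _ /=.
by rewrite !ffunE mulrDr scalerAr.
Qed.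
HB.instance Definition _ a := GRing.isLinear.Build F _ _ _ (dot a) (dot_linear a).

Lemma dotC a x : dot a x = dot x a.
Proof. by apply: eq_bigr => i _; rewrite mulrC. Qed.

Lemma dot_scalev a c x : dot a (scalev c x) = c * dot a x.
Proof. by rewrite mulr_sumr; apply: eq_bigr => i _; rewrite ffunE mulrCA. Qed.

Definition dotf a : 'Hom(vecF L m, L) := linfun (dot a).

Lemma dotfE a x : dotf a x = dot a x. Proof. exact: lfunE. Qed.

Lemma dotf_linear x : linear (dotf^~ x).
Proof. by move=> k a b; rewrite !dotfE !(dotC _ x) linearP. Qed.

Lemma dot_surj a t : a != 0 -> exists x, dot a x = t.
Proof.
move=> a0; have [i ai0] : exists i, a i != 0.
  apply/existsP; apply: contraNT a0; rewrite negb_exists => /forallP a0.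
  by apply/eqP/ffunP => i; rewrite ffunE; apply/eqP; have := a0 i; rewrite negbK.
exists [ffun j => if j == i then t / a i else 0].
rewrite /dot (bigD1 i) //= big1 => [|j /negPf ji]; rewrite ffunE ?ji ?mulr0 //.
by rewrite eqxx addr0 mulrC divfK.
Qed.

Lemma dimv_vecF : \dim {: vecF L m} = (m * n)%N.
Proof. by rewrite !dimvf /dim /= card_ord. Qed.

Lemma dimv_vecL : \dim {: vecL L m} = m.
Proof. by rewrite dimvf /dim /= card_ord /dim /= muln1. Qed.

Lemma sub_resF_span U : (U <= resF <<vbasis U : seq (vecL L m)>>)%VS.
Proof.
have {1}<- : <<vbasis U>>%VS = U by exact: span_basis (vbasisP U).
by apply/span_subvP => u uU; rewrite mem_resF memv_span.
Qed.

Lemma spanning_dimv U : spanning U -> (m <= \dim U)%N.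
Proof.
move=> /(_ <<vbasis U : seq (vecL L m)>>%VS) spU.
have /(congr1 (fun X => \dim X)) : <<vbasis U : seq (vecL L m)>>%VS = fullv.
  apply: spU => _ [u [uU _ ->]]; rewrite -memvE -mem_resF.
  exact: (subvP (sub_resF_span U)).
rewrite dimv_vecL => dW; rewrite -[X in (X <= _)%N]dW.
by apply: leq_trans (dim_span _) _; rewrite size_tuple.
Qed.

(** If the basis of [X] were dependent over F_{q^n}, its span would fit into some [W'] of dimension
    [h], whose weight is then at least [h.+1]. *)
Lemma scattered_free h U (X : {vspace vecF L m}) :
    scattered h U -> (h <= m)%N -> (X <= U)%VS -> \dim X = h.+1 ->
  free (vbasis X : seq (vecL L m)).
Proof.
move=> [_ scU] hm sXU dX; set W := <<vbasis X : seq (vecL L m)>>%VS.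
rewrite /free eqn_leq dim_span /= size_tuple leqNgt -/W; apply/negP.
rewrite [X in (_ < X)%N]dX ltnS => leW.
have [|W' [WW' _ dW']] := @exists_subv_between _ _ W fullv h (subvf _).
  by rewrite leW dimv_vecL.
have := scU W' dW'; rewrite leqNgt => /negP; apply; rewrite -dX /weight.
apply: dimvS; rewrite subv_cap sXU /=.
apply/subvP => x xX; rewrite mem_resF; apply: (subvP WW').
rewrite -mem_resF; exact: (subvP (sub_resF_span X)).
Qed.

(** The [u i] lie in some [X] as in [scattered_free]. Freeness of its basis over F_{q^n} splits the
    relation into relations between the [c i], whose coefficients are the F_q-coordinates of the
    [u i]; these must vanish. *)
Lemma scattered_indep h U (c : 'I_h.+1 -> L) (u : 'I_h.+1 -> vecF L m) :
    scattered h U -> (h < m)%N -> free [tuple c i | i < h.+1] ->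
    (forall i, u i \in U) -> \sum_i scalev (c i) (u i) = 0 ->
  forall i, u i = 0.
Proof.
move=> scU hm fc uU cu0.
have leU := spanning_dimv scU.1.
have [||X [uX XU dX]] := @exists_subv_between _ _ <<[tuple u i | i < h.+1]>> U h.+1.
- by apply/span_subvP => _ /mapP[i _ ->].
- rewrite (leq_trans hm leU) andbT; apply: leq_trans (dim_span _) _.
  by rewrite size_tuple.
have fX := scattered_free scU (ltnW hm) XU dX.
pose k i j := coord (vbasis X) j (u i).
have uE i : u i = \sum_j k i j *: (vbasis X)`_j.
  apply: coord_vbasis; apply: (subvP uX); apply: memv_span.
  by apply/mapP; exists i; rewrite ?mem_enum.
have sum0 : \sum_j (\sum_i k i j *: c i : L) *: ((vbasis X)`_j : vecL L m) = 0.
  rewrite -[RHS]cu0; under [RHS]eq_bigr => i _ do rewrite uE linear_sum.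
  rewrite exchange_big; apply: eq_bigr => j _ /=.
  rewrite -scalevE; apply/ffunP => l; rewrite ffunE sum_ffunE mulr_suml.
  by apply: eq_bigr => i _; rewrite !ffunE -scalerAl -scalerAr.
move=> i; rewrite uE big1 // => j _.
have /freeP/(_ _ sum0 j) kj0 := fX.
have /freeP/(_ (k^~ j)) kc := fc; rewrite kc ?scale0r // -[RHS]kj0.
by apply: eq_bigr => l _; rewrite -tnth_nth tnth_mktuple.
Qed.
End Dot.

(** As a pairing, [mulf u v] is [v * u], so [colon mulf H T] consists of the scalars c with cT
    inside [H]. *)
Definition mulf (c : L) : 'Hom(L, L) := amulr c.

Lemma mulf_linear x : linear (mulf^~ x).
Proof. by move=> k a b; rewrite !lfunE /= mulrDr scalerAr. Qed.

Lemma exists_hyperplane : exists H : {vspace L}, \dim H = n.-1.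
Proof.
have [|H [_ _ dH]] := @exists_subv_between _ L 0%VS fullv n.-1 (subvf _).
  by rewrite dimv0 leq_pred.
by exists H.
Qed.

(** * Images of a properly maximum scattered subspace: bounds and existence *)

Section MaxScattered.
Variables (d h : nat) (U1 : {vspace vecF L d}).
Hypotheses (hd : (h < d)%N) (scU : prop_max_scattered h U1).
Local Notation N := (\dim U1).

Lemma scattered_sum_full (c : 'I_h.+1 -> L) : free [tuple c i | i < h.+1] ->
  (\sum_i (linfun (@scalev F L d (c i)) @: U1))%VS = fullv.
Proof.
move=> fc; apply/eqP; rewrite eqEdim subvf dimv_vecF -scU.2.
have c0 i : c i != 0.
  by apply: free_not0 fc _; apply/mapP; exists i; rewrite ?mem_enum.
have /directvP -> /= : directv (\sum_i (linfun (@scalev F L d (c i)) @: U1)).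
  apply/directv_sum_independent => us usU us0 i _.
  have [u uU usE] := fin_all_exists2 (fun j => memv_imgP (usU j isT)).
  rewrite usE lfunE /= [u i](scattered_indep scU.1 hd fc uU) ?linear0 //.
  by rewrite -[RHS]us0; apply: eq_bigr => j _; rewrite usE lfunE.
rewrite (eq_bigr (fun=> N)) => [|i _].
  by rewrite sum_nat_const card_ord mulnC.
apply: limg_dim_eq; apply/eqP; rewrite -subv0; apply/subvP => x.
rewrite memv_cap memv_ker lfunE /= memv0 => /andP[_ /eqP/ffunP x0].
apply/eqP/ffunP => j; have /eqP := x0 j.
by rewrite !ffunE mulf_eq0 (negPf (c0 i)) => /eqP.
Qed.

(** Combine N(h+1) = dn with d <= N, which holds because [U1] spans. *)
Lemma ltn_scattered : (h < n)%N.
Proof.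
have := spanning_dimv scU.1.1; have := scU.2; have := hd; nia.
Qed.

Lemma leq_scattered : (n <= N)%N.
Proof. have := scU.2; have := hd; nia. Qed.

Lemma dimv_dot_ge a : a != 0 -> (n <= \dim (dotf a @: U1) + h)%N.
Proof.
move=> a0; set T := (dotf a @: U1)%VS; rewrite leqNgt; apply/negP => ltT.
have [H dH] := exists_hyperplane.
have codimH : (n - n.-1 = 1)%N by have := ltn_scattered; lia.
(* Sending [T] into the hyperplane [H] costs at most [\dim T] conditions on the scalar, so at least
   h+1 dimensions of scalars remain. *)
have := dimv_colonf_ge mulf H T; rewrite dH codimH muln1 => geC.
have [||X [_ XC dX]] := @exists_subv_between _ _ 0%VS (colon mulf H T) h.+1.
- exact: sub0v.
- rewrite dimv0 /= -(leq_add2r (\dim T)) (leq_trans _ geC) //.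
  by rewrite addSn addnC.
pose c (i : 'I_h.+1) := (vbasis X)`_i.
have fc : free [tuple c i | i < h.+1].
  rewrite (_ : tval _ = vbasis X) ?(basis_free (vbasisP X)) //.
  apply: (@eq_from_nth _ 0); rewrite !size_tuple // => i ih.
  by rewrite -[i]/(val (Ordinal ih)) -tnth_nth tnth_mktuple.
(* The form [a] takes every value, yet on the sum of the c_i U1, which is the whole space, its
   values stay in [H]. *)
suff : (fullv <= H)%VS by move/dimvS; rewrite dH; lia.
apply/subvP => t _; have [x <-] := dot_surj t a0.
have := memvf x; rewrite -(scattered_sum_full fc) => /memv_sumP[us usU ->].
rewrite linear_sum; apply: memv_suml => i _.
have /memv_imgP[u uU ->] := usU i isT; rewrite lfunE /= dot_scalev.
have /(mem_colonP mulf_linear)/(_ (dot a u)) : c i \in colon mulf H T.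
  apply: (subvP XC); apply: vbasis_mem.
  by apply: mem_nth; rewrite size_tuple dX.
by rewrite lfunE /=; apply; rewrite -dotfE memv_img.
Qed.

(** By the symmetry of [dot], these are the forms [a] that map [U1] into [S]. *)
Local Notation multsInto S := (colon (@dotf d) S U1).

(** Mapping a basis of [U1] into [S] is at most Ni conditions on the forms, which make up a space of
    dimension dn = N(h+1). *)
Lemma dimv_multsInto_ge (S : {vspace L}) i : \dim S = (n - i)%N -> (i <= h)%N ->
  (N * (h.+1 - i) <= \dim (multsInto S))%N.
Proof.
move=> dS ih; have := dimv_colonf_ge (@dotf d) S U1; rewrite dimv_vecF -scU.2 dS.
rewrite subKn => [le|]; last exact: leq_trans ih (ltnW ltn_scattered).
by rewrite mulnBr leq_subLR addnC.
Qed.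

Lemma mem_multsInto (S : {vspace L}) a :
  (a \in multsInto S) = (dotf a @: U1 <= S)%VS.
Proof.
apply/(mem_colonP (@dotf_linear d))/subvP => [aS _ /memv_imgP[u uU ->]|aS u uU].
  by rewrite dotfE dotC -dotfE aS.
by rewrite dotfE dotC -dotfE aS ?memv_img.
Qed.

(** Pick [S'] in [S] of dimension n-h-1. By [dimv_dot_ge] only the zero form maps [U1] into [S'],
    while passing from [S] to [S'] costs at most N conditions per dimension. *)
Lemma dimv_multsInto_le (S : {vspace L}) : (n <= \dim S + h.+1)%N ->
  (\dim (multsInto S) <= N * (\dim S + h.+1 - n))%N.
Proof.
move=> geS; have hn := ltn_scattered.
have [||S' [_ S'S dS']] := @exists_subv_between _ _ 0%VS S (n - h.+1).
- exact: sub0v.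
- by rewrite dimv0 /=; lia.
have codimS : (\dim S + h.+1 - n = \dim S - \dim S')%N by rewrite dS'; lia.
have := @dimv_colon_ge _ _ _ _ (@dotf d) (multsInto S) S' S U1 S'S.
have -> : (multsInto S :&: multsInto S' = 0)%VS.
  apply/eqP; rewrite -subv0; apply/subvP => a /memv_capP[_].
  rewrite mem_multsInto memv0 => /dimvS leS'; apply: contraT => /dimv_dot_ge.
  by move: hn leS'; rewrite dS'; dimlia.
rewrite dimv0 add0n codimS; apply=> u uU; apply/subvP => x /memv_imgP[a].
rewrite mem_multsInto => aS ->.
by rewrite dotfE dotC -dotfE (subvP aS) ?memv_img.
Qed.

(** Compare dimensions: [colon mulf H T] has at least n - dim T. As [colon mulf H S] meets
    [colon mulf H S^C] only in 0, it has at most n - dim S. *)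
Lemma exists_separating_mult (H S T : {vspace L}) :
    \dim H = n.-1 -> (\dim T < \dim S)%N ->
  exists2 c, c \in colon mulf H T & c \notin colon mulf H S.
Proof.
move=> dH ltTS; apply: memv_notin.
have := dimv_colonf_ge mulf H T.
have := @dimv_colon_ge _ _ _ _ mulf (colon mulf H S) H fullv (S^C)%VS (subvf _)
  (fun _ _ => subvf _).
have -> : (colon mulf H S :&: colon mulf H S^C = 0)%VS.
  apply/eqP; rewrite -subv0; apply/subvP => c /memv_capP[cS cS'].
  rewrite memv0; apply: contraT => c0.
  suff : (fullv <= H)%VS by move/dimvS; rewrite dH; have := ltn_scattered; lia.
  apply/subvP => x _.
  have : c^-1 * x \in (S + S^C)%VS by rewrite addv_complf memvf.
  move=> /memv_addP[s sS [s' sS' xE]].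
  have -> : x = c * s + c * s' by rewrite -mulrDr -xE mulVKf.
  apply: memvD.
    by have := mem_colonP mulf_linear _ _ _ cS _ sS; rewrite lfunE.
  by have := mem_colonP mulf_linear _ _ _ cS' _ sS'; rewrite lfunE.
have -> : (\dim {:L} - \dim H = 1)%N by rewrite dH; have := ltn_scattered; lia.
by rewrite dimv0 dimv_compl !muln1; move: ltTS (dimvS (subvf S)); dimlia.
Qed.

(** Otherwise each form into [S] has a smaller image T, and a scalar c with cT but not cS inside [H]
    puts the form into [multsInto (Hc c)]. Covering by these gives N(h+1-i) < n + N(h-i), against n
    <= N. *)
Lemma exists_dot_image (S : {vspace L}) i : \dim S = (n - i)%N -> (i <= h)%N ->
  exists a, (dotf a @: U1)%VS = S.
Proof.
move=> dS ih; apply: contrapT => /forallNP noS.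
have [H dH] := exists_hyperplane.
have [hn nN] := (ltn_scattered, leq_scattered).
pose Hc c := (S :&: amull c @^-1: H)%VS.
pose P : pred L := fun c => c \notin colon mulf H S.
(* If cS is not inside [H], the vectors of [S] that c sends into [H] form a hyperplane of [S]. *)
have dHc c : P c -> \dim (Hc c) = (n - i.+1)%N.
  move=> Pc; apply/eqP; rewrite eqn_leq; apply/andP; split.
    have dS1 : ((n - i.+1).+1 = \dim S)%N by rewrite dS; move: hn ih; dimlia.
    rewrite -ltnS dS1.
    rewrite ltn_neqAle dimvS ?capvSl // andbT; apply: contra Pc => /eqP eqd.
    apply/(mem_colonP mulf_linear) => u uS; rewrite lfunE /=.
    have : u \in Hc c by rewrite (eqP (_ : Hc c == S)) // eqEdim capvSl eqd leqnn.
    by rewrite memv_cap -memv_preim lfunE => /andP[].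
  have := @dimv_preim_ge _ _ _ (amull c) S H fullv (subvf _) (subvf _).
  by rewrite dS dH -/(Hc c); move: hn ih; dimlia.
have : (\dim (multsInto S) < \dim {:L} + N * (h - i))%N.
  apply: (@dimv_cover_lt _ _ L _ P (fun c => multsInto (Hc c))).
  - by rewrite negbK mem0v.
  - move=> a; rewrite mem_multsInto => aS.
    have ltS : (\dim (dotf a @: U1) < \dim S)%N.
      rewrite ltn_neqAle dimvS // andbT; apply/eqP => eqd; apply: (noS a).
      by apply/eqP; rewrite eqEdim aS eqd leqnn.
    have [c cT cS] := exists_separating_mult dH ltS; exists c => //.
    rewrite mem_multsInto subv_cap aS; apply/subvP => t tT.
    rewrite -memv_preim lfunE /=.
    by have := mem_colonP mulf_linear _ _ _ cT _ tT; rewrite lfunE.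
  - move=> c Pc; have := @dimv_multsInto_le (Hc c); rewrite (dHc c Pc).
    have -> : (n - i.+1 + h.+1 - n = h - i)%N by move: hn ih; dimlia.
    by apply; move: hn ih; dimlia.
apply/negP; rewrite -leqNgt.
apply: leq_trans (dimv_multsInto_ge dS ih).
by rewrite subSn // mulnS leq_add2r.
Qed.

End MaxScattered.
End Scattered.

(** * Counting the points of a linear set *)

Lemma card_eq_uniq_seq (T : choiceType) (s : seq T) (A : set T) :
  uniq s -> (forall x, A x <-> x \in s) -> (A #= `I_(size s))%card.
Proof.
move=> us As; apply/card_set_bijP; exists (index^~ s); split => [x|x y|i] /=.
- by rewrite /mkset index_mem => /As.
- by move=> /set_mem/As xs /set_mem/As ys; apply: (index_inj x).
(* [nth] needs a default element; if [T] is empty, so is [s], and no index exists. *)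
move=> ilt; have [[x0 _]|s0] := pselect (exists x0 : T, True); last first.
  by case: s ilt {us As} s0 => // x s _ []; exists x.
by exists (nth x0 s i); rewrite /= ?index_uniq //; apply/As/mem_nth.
Qed.

(** Serves to count points: in a list of the points spanned by vectors, each point is repeated once
    per vector spanning it. *)
Lemma size_undup_uniform (T : eqType) (s : seq T) c :
  (forall x, x \in s -> count_mem x s = c) -> size s = (c * size (undup s))%N.
Proof.
move=> sc; rewrite -(perm_size (perm_count_undup s)) size_flatten /shape -map_comp.
have -> : [seq (size \o (fun x => nseq (count_mem x s) x)) x | x <- undup s]
    = [seq c | _ <- undup s].
  by apply/eq_in_map => x; rewrite mem_undup => xs; rewrite /= size_nseq sc.
by rewrite sumnE big_map big_const_seq count_predT iter_addn_0.
Qed.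

Lemma mul_gauss q k : ((q - 1) * gauss q k = q ^ k - 1)%N.
Proof.
rewrite /gauss mulnC divnK // !subn1 predn_exp; exact: dvdn_mulr.
Qed.

Lemma gaussS q k : (1 < q)%N -> (gauss q k + q ^ k = gauss q (k + 1))%N.
Proof.
move=> q1; apply/eqP; rewrite -(@eqn_pmul2l (q - 1)) ?subn_gt0 //.
rewrite mulnDr !mul_gauss addn1 expnS mulnBl mul1n.
have : (0 < q ^ k)%N by rewrite expn_gt0 (ltnW q1).
by move: (q ^ k)%N => x x0; apply/eqP; nia.
Qed.

Section CountPoints.
Variables (F : finFieldType) (L : fieldExtType F) (m : nat).
Local Notation n := (\dim {:L}%VS).
Local Notation q := #|F|.
Local Notation fV := (finvect_type (vecF L m)).
Variables U V : {vspace vecF L m}.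
Hypotheses (sVU : (V <= U)%VS) (V_stable : forall c v, v \in V -> scalev c v \in V).
Hypothesis U_scattered : forall c u,
  u \in U -> u \notin V -> scalev c u \in U -> exists k : F, c = k%:A.

Lemma vline_eqP (x y : vecF L m) : x != 0 ->
  reflect (exists2 c : L, c != 0 & y = scalev c x)
          (<[y : vecL L m]>%VS == <[x : vecL L m]>%VS).
Proof.
move=> x0; apply: (iffP eqP) => [yx|[c c0 ->]].
  have /vlineP[c yE] : (y : vecL L m) \in <[x : vecL L m]>%VS.
    by rewrite -yx memv_line.
  exists c; last by rewrite scalevE.
  apply: contraNneq x0 => c0; have : (x : vecL L m) \in <[y : vecL L m]>%VS.
    by rewrite yx memv_line.
  by rewrite yE c0 scale0r => /vlineP[k ->]; rewrite scaler0.
apply/eqP; rewrite scalevE eqEsubv -!memvE memvZ ?memv_line //=.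
have xE : (x : vecL L m) = c^-1 *: (c *: (x : vecL L m)) by rewrite scalerK.
by rewrite [X in X \in _]xE memvZ ?memv_line.
Qed.

Lemma scalev_inj (x : vecF L m) : x != 0 -> injective (fun c => scalev c x).
Proof.
move=> x0 c c' eqc; apply/eqP; rewrite -subr_eq0; apply: contraNT x0 => cc'.
apply/eqP/ffunP => i; rewrite ffunE.
have /ffunP/(_ i) := eqc; rewrite !ffunE => /eqP; rewrite -subr_eq0 -mulrBl.
by rewrite mulf_eq0 (negPf cc') => /eqP.
Qed.

Lemma scalev0 (x : vecF L m) : scalev 0 x = 0.
Proof. by apply/ffunP => i; rewrite !ffunE mul0r. Qed.

(** A point of [pi] inside [V] is spanned by q^n - 1 vectors of [Y], any other by q - 1 vectors of
    [X] outside [Y]. Dividing q^(nk) - 1 and q^(nk+e) - q^(nk) by these numbers gives the two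
    terms. *)
Lemma card_linset_cap (pi : {vspace vecL L m}) k e :
    \dim (V :&: resF pi) = (n * k)%N -> \dim (U :&: resF pi) = (n * k + e)%N ->
  (linset U `&` [set P | (P <= pi)%VS]
     #= `I_(q ^ (n * k) * gauss q e + gauss (q ^ n) k))%card.
Proof.
move=> dV dU; have q1 : (1 < #|F|)%N := finNzRing_gt1 F.
set X := (U :&: _)%VS in dU; set Y := (V :&: _)%VS in dV.
pose E (W : {vspace vecF L m}) := [set x : fV | (x : vecF L m) \in W].
have card_E W : #|E W| = (#|F| ^ \dim W)%N by rewrite cardsE card_vspace_pred.
pose P1 := E Y :\ 0; pose P2 := E X :\: E Y.
have sYX : E Y \subset E X.
  by apply/fintype.subsetP => x; rewrite !inE; apply/subvP/capvS.
pose f (x : fV) : {vspace vecL L m} := <[x : vecL L m]>%VS.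
pose s1 := [seq f x | x <- enum P1]; pose s2 := [seq f x | x <- enum P2].
have count_enum (P : {set fV}) t :
    count_mem t [seq f x | x <- enum P] = #|[set x in P | f x == t]|.
  rewrite count_map cardE /enum_mem size_filter count_filter.
  by apply: eq_count => x; rewrite /= !inE andbC.
have memX x : x \in X = (x \in U) && ((x : vecL L m) \in pi).
  by rewrite memv_cap mem_resF.
have memY x : x \in Y = (x \in V) && ((x : vecL L m) \in pi).
  by rewrite memv_cap mem_resF.
have size1 : size (undup s1) = gauss (q ^ n) k.
  have qn1 : (0 < q ^ n - 1)%N.
    by rewrite subn_gt0 -(expn0 q) ltn_exp2l // adim_gt0.
  apply/eqP; rewrite -(eqn_pmul2l qn1) mul_gauss -expnM; apply/eqP.
  rewrite -[LHS](size_undup_uniform (s := s1)).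
    have := cardsD1 (0 : fV) (E Y); rewrite card_E dV inE mem0v /= add1n.
    by rewrite size_map -cardE subn1 => ->.
  move=> t /mapP[x]; rewrite mem_enum !inE => /andP[x0 xY] ->.
  rewrite count_enum.
  (* [V] and [pi] are closed under F_{q^n}, so the fibre consists of all nonzero multiples of
     [x]. *)
  have -> : [set y in P1 | f y == f x]
      = (fun c : finvect_type L => scalev (c : L) x : fV) @: [set~ 0].
    apply/finset.setP => y; rewrite !inE; apply/idP/imsetP.
      case/andP=> _ /(vline_eqP _ x0)[c c0 yE]; exists c => //.
      by rewrite !inE.
    case=> c; rewrite !inE => c0 ->; apply/andP; split; last first.
      by apply/vline_eqP => //; exists c.
    move: xY; rewrite !memY => /andP[xV xpi]; rewrite V_stable //=.
    rewrite scalevE memvZ // andbT -scalevE.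
    by apply: contraNneq c0 => cx0; apply/eqP/(scalev_inj x0); rewrite cx0 scalev0.
  rewrite card_imset; last exact: scalev_inj.
  rewrite cardsC1 -(card_vspace_pred {:L}%VS) subn1; congr _.-1.
  by apply: eq_card => c; rewrite !inE memvf.
have size2 : size (undup s2) = (q ^ (n * k) * gauss q e)%N.
  have q10 : (0 < q - 1)%N by rewrite subn_gt0.
  apply/eqP; rewrite -(eqn_pmul2l q10) mulnCA mul_gauss mulnBr muln1 -expnD.
  apply/eqP.
  rewrite -[LHS](size_undup_uniform (s := s2)).
    by rewrite size_map -cardE cardsD (finset.setIidPr sYX) !card_E dU dV.
  move=> t /mapP[x]; rewrite mem_enum !inE => /andP[xY xX] ->.
  rewrite count_enum.
  have x0 : (x : vecF L m) != 0 by apply: contraNneq xY => ->; rewrite mem0v.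
  (* By [U_scattered] only the multiples by scalars of F_q stay in [U]. *)
  have -> : [set y in P2 | f y == f x]
      = (fun l : F => scalev (l%:A : L) x : fV) @: [set~ 0].
    apply/finset.setP => y; rewrite !inE; apply/idP/imsetP.
      case/andP=> /andP[yY yX] /(vline_eqP _ x0)[c c0 yE].
      move: xX xY yX; rewrite !memX memY yE => /andP[xU ->].
      rewrite andbT => xV /andP[cxU _].
      have [l cE] := U_scattered xU xV cxU; exists l; rewrite ?cE // !inE.
      by apply: contraNneq c0 => l0; rewrite cE l0 scale0r.
    case=> l; rewrite !inE => l0 ->; rewrite -scaleFE; apply/andP; split.
      by rewrite !rpredZeq (negPf l0) /= xY xX.
    rewrite scaleFE; apply/vline_eqP => //; exists l%:A => //.
    by rewrite scaler_eq0 (negPf l0) oner_eq0.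
  rewrite card_imset ?cardsC1 ?subn1 // => c c' /(scalev_inj x0).
  by move/(fmorph_inj (in_alg L)).
rewrite -size1 -size2 addnC -size_cat.
apply: card_eq_uniq_seq => [|P].
  (* The two kinds of points are disjoint, as a multiple of a vector of [V] is in [V]. *)
  rewrite cat_uniq !undup_uniq andbT /=; apply/hasPn => P.
  rewrite !mem_undup => /mapP[x]; rewrite mem_enum !inE => /andP[xY xX] ->.
  apply: contra xY => /mapP[y]; rewrite mem_enum !inE => /andP[y0 yY] /eqP.
  case/(vline_eqP _ y0) => c c0 xE.
  move: xX yY; rewrite memX !memY => /andP[_ ->] /andP[yV _].
  by rewrite andbT xE V_stable.
rewrite mem_cat !mem_undup; split.
  case=> -[u [uU u0 ->]] /=; rewrite -memvE => upi.
  have [uV|uV] := boolP (u \in V); apply/orP; [left|right]; apply/mapP; exists u => //.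
    by rewrite mem_enum !inE memY uV upi u0.
  by rewrite mem_enum !inE memY memX uU upi (negPf uV).
case/orP => /mapP[u]; rewrite mem_enum !inE ?memX memY.
  case/and3P => u0 uV upi ->; split; last by rewrite /= -memvE.
  by exists u; split => //; apply: (subvP sVU).
case/and3P=> uV uU upi ->; split; last by rewrite /= -memvE.
by exists u; split => //; apply: contraNneq uV => ->; rewrite !mem0v.
Qed.
End CountPoints.

(** * Hyperplanes and cones *)

Section Hyperplanes.
Variables (F : finFieldType) (L : fieldExtType F) (m : nat).
Local Notation n := (\dim {:L}%VS).

Definition dotL (b x : vecL L m) : L^o := dot (b : vecF L m) x.

Fact dotL_linear b : linear (dotL b).
Proof.
move=> c x y; rewrite -scalevE /dotL.
by rewrite -[RHS]/(c * dot (b : vecF L m) x + dot (b : vecF L m) y)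
     -dot_scalev -linearD.
Qed.
HB.instance Definition _ b :=
  GRing.isLinear.Build L _ _ _ (dotL b) (dotL_linear b).

Definition orth (b : vecF L m) : {vspace vecL L m} := lker (linfun (dotL b)).

Lemma mem_orth b x : (x \in orth b) = (dot b x == 0).
Proof. by rewrite memv_ker lfunE. Qed.

Lemma dimv_orth b : b != 0 -> (\dim (orth b)).+1 = m.
Proof.
move=> b0; have := limg_ker_dim (linfun (dotL b)) fullv.
rewrite capfv dimv_vecL (_ : limg _ = fullv) ?dimvf ?/dim ?addn1 //.
apply/vspaceP => t; rewrite memvf; have [x xE] := dot_surj t b0.
by rewrite -[t]xE -[dot b x]/(dotL b x) -lfunE memv_img ?memvf.
Qed.

(** Rank-nullity: the weight of a hyperplane is read off the image under its form. *)
Lemma dimv_cap_orth (W : {vspace vecF L m}) b :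
  (\dim (W :&: resF (orth b)) + \dim (dotf b @: W) = \dim W)%N.
Proof.
rewrite -(limg_ker_dim (dotf b) W); congr (\dim _ + _)%N.
by apply/vspaceP => x; rewrite !memv_cap mem_resF mem_orth memv_ker dotfE.
Qed.

(** Vanishing on [pi] is at most m-1 conditions on [b], so a nonzero [b] remains; equal dimensions
    then give [pi = orth b]. *)
Lemma hyperplane_orth (pi : {vspace vecL L m}) : (\dim pi).+1 = m ->
  exists2 b, b != 0 & pi = orth b.
Proof.
move=> dpi; pose B (u : vecL L m) := linfun (dotL u).
have Blin v : linear (B^~ v).
  move=> k a b; rewrite !lfunE /= /dotL dotC (dotC a) (dotC b).
  exact: dotL_linear.
have := dimv_colonf_ge B 0%VS pi.
rewrite dimv_vecL dimv0 subn0 [X in (_ * X)%N](_ : _ = 1%N); last first.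
  by rewrite dimvf /dim.
rewrite muln1 => geC.
have [|b bC b0] := @memv_notin _ _ (colon B 0 pi) 0%VS.
  by move: geC dpi; rewrite dimv0; dimlia.
rewrite memv0 in b0; exists b => //; apply/eqP; rewrite eqEdim.
rewrite -ltnS dimv_orth // dpi leqnn andbT; apply/subvP => x xpi.
have := mem_colonP Blin _ _ _ bC _ xpi; rewrite memv0 lfunE /= mem_orth.
by rewrite /dotL dotC.
Qed.
End Hyperplanes.

(** Points have weight 1: as h > 0, both [x] and [scalev c x] fit into some [X] of dimension h+1,
    whose basis is free over F_{q^n}. Comparing coordinates makes c a quotient of elements of
    F_q. *)
Lemma scattered_point (F : finFieldType) (L : fieldExtType F) m h
    (U : {vspace vecF L m}) c x :
    scattered h U -> (0 < h < m)%N -> x \in U -> x != 0 -> scalev c x \in U ->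
  exists k : F, c = k%:A.
Proof.
move=> scU /andP[h0 hm] xU x0 cxU; have leU := spanning_dimv scU.1.
have [||X [sX XU dX]] := @exists_subv_between _ _ <<[:: x; scalev c x]>> U h.+1.
- by apply/span_subvP => z; rewrite !inE => /orP[]/eqP->.
- rewrite (leq_trans hm leU) andbT; apply: leq_trans (dim_span _) _.
  by rewrite ltnS.
have fX := scattered_free scU (ltnW hm) XU dX.
have /coord_vbasis xE : x \in X by apply: (subvP sX); rewrite memv_span ?inE ?eqxx.
have /coord_vbasis cxE : scalev c x \in X.
  by apply: (subvP sX); rewrite memv_span ?inE ?eqxx ?orbT.
set k := (fun j => coord (vbasis X) j x) in xE.
set k' := (fun j => coord (vbasis X) j (scalev c x)) in cxE.
have ck j : c * (k j)%:A = (k' j)%:A.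
  have /freeP/(_ (fun j => c * (k j)%:A - (k' j)%:A)) := fX => /(_ _ j) eq0.
  apply/eqP; rewrite -subr_eq0 eq0 //.
  transitivity (scalev c x - scalev c x); last exact: subrr.
  rewrite {2}cxE {1}xE linear_sum -sumrB; apply: eq_bigr => l _ /=.
  rewrite -scalevE; apply/ffunP => i.
  by rewrite !ffunE mulrBl -mulrA !mulr_algl.
have [j kj0] : exists j, k j != 0.
  apply/existsP; apply: contraNT x0; rewrite negb_exists => /forallP k0.
  rewrite xE big1 // => j _; have := k0 j; rewrite negbK -/(k j) => /eqP->.
  by rewrite scale0r.
exists (k' j / k j); rewrite mulrC -scalerA -ck scalerAr scalerA mulVf //.
by rewrite scale1r mulr1.
Qed.

(** * Cones and their vertex [cone r 0] *)

Section Cone.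
Variables (F : finFieldType) (L : fieldExtType F) (r d : nat).
Hypothesis dr : (d < r)%N.
Local Notation n := (\dim {:L}%VS).
Local Notation first := (@firstcoords F L r d).

(** A section of [firstcoords]: [insub] fails exactly on the indices from [d] on, which receive
    0. *)
Definition padzero (z : vecF L d) : vecF L r.+1 :=
  [ffun i : 'I_r.+1 => oapp z 0 (insub (val i))].

Lemma padzeroK z : first (padzero z) = z.
Proof.
apply/ffunP => i; rewrite !ffunE /= inordK ?valK //.
by rewrite (leq_trans (ltn_ord i)) // ltnW // ltnW.
Qed.

Lemma padzero_last z : padzero z ord_max = 0.
Proof. by rewrite ffunE insubN //= -leqNgt ltnW. Qed.

Lemma dot_padzero b z : dot b (padzero z) = dot (first b) z.
Proof.
pose G (i : nat) : L := b (inord i) * oapp z 0 (insub i).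
transitivity (\sum_(i < d) G i); last first.
  by apply: eq_bigr => i _; rewrite /G ffunE valK.
rewrite (big_ord_widen r.+1) ?big_mkcond; last by rewrite ltnW // ltnW.
apply: eq_bigr => i _; rewrite ffunE /G inord_val; case: ltnP => // di.
by rewrite insubN ?mulr0 // -leqNgt.
Qed.

Lemma mem_coneE (W : {vspace vecF L d}) x :
  (x \in cone r W) = (first x \in W) && (x ord_max == 0).
Proof. exact: mem_cone. Qed.

Lemma dimv_cone_base (W : {vspace vecF L d}) :
  \dim (cone r W) = (\dim W + \dim (cone r (0 : {vspace vecF L d})))%N.
Proof.
have imgE : (linfun first @: cone r W = W)%VS.
  apply/vspaceP => z; apply/memv_imgP/idP => [[x]|zW].
    by rewrite mem_coneE => /andP[xW _] ->; rewrite lfunE.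
  exists (padzero z); last by rewrite lfunE /= padzeroK.
  by rewrite mem_coneE padzeroK zW padzero_last eqxx.
have kerE : (cone r W :&: lker (linfun first) = cone r (0 : {vspace vecF L d}))%VS.
  apply/vspaceP => x; rewrite memv_cap memv_ker lfunE /= !mem_coneE memv0.
  by case: (first x =P 0) => [->|_]; rewrite ?andbF // mem0v andbT.
by rewrite -(limg_ker_dim (linfun first) (cone r W)) imgE kerE addnC.
Qed.

(** The cone over the full base is the hyperplane at infinity, of F_q-dimension rn; the base
    accounts for dn of it. *)
Lemma dimv_vertex : \dim (cone r (0 : {vspace vecF L d})) = (n * (r - d))%N.
Proof.
have := dimv_cone_base fullv; rewrite dimv_vecF.
have -> : \dim (cone r (fullv : {vspace vecF L d})) = (r * n)%N.
  have := limg_ker_dim (linfun (@lastcoordF F L r)) fullv.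
  rewrite capfv dimv_vecF mulSn addnC.
  have -> : limg (linfun (@lastcoordF F L r)) = fullv.
    apply/vspaceP => t; rewrite memvf; apply/memv_imgP.
    by exists [ffun=> t]; rewrite ?memvf // lfunE /= /lastcoordF ffunE.
  move/addnI => <-; congr (\dim _); apply/vspaceP => x.
  by rewrite mem_coneE memvf memv_ker lfunE.
rewrite mulnC [(d * n)%N]mulnC mulnBr => ->.
by rewrite addnC addnK.
Qed.

Lemma cone_stable (W : {vspace vecF L d}) c v :
  (forall x, x \in W -> scalev c x \in W) ->
  v \in cone r W -> scalev c v \in cone r W.
Proof.
move=> Wst; rewrite !mem_coneE => /andP[vW /eqP v0].
rewrite ffunE v0 mulr0 eqxx andbT.
have -> : first (scalev c v) = scalev c (first v) by apply/ffunP => i; rewrite !ffunE.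
exact: Wst.
Qed.

End Cone.

(** * Sections of the linear set defined by the cone and an affine point *)

Section ConeOverScattered.
Variables (F : finFieldType) (L : fieldExtType F) (r d h : nat).
Variables (U1 : {vspace vecF L d}) (y : vecF L r.+1).
Hypotheses (dr : (d < r)%N) (hd : (0 < h < d)%N).
Hypotheses (scU : prop_max_scattered h U1) (y_affine : y ord_max != 0).
Local Notation q := #|F|.
Local Notation n := (\dim {:L}%VS).
Local Notation N := (\dim U1).
Local Notation first := (@firstcoords F L r d).
Local Notation V := (cone r (0 : {vspace vecF L d})).
Local Notation U' := (cone r U1 + <[y]>)%VS.
Local Notation B := (linset U').

Lemma dimv_affine_cone : \dim U' = (n * (r - d) + N.+1)%N.
Proof.
have yC : y \notin cone r U1 by rewrite mem_coneE (negPf y_affine) andbF.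
by rewrite (dimv_add_line yC) (dimv_cone_base dr) (dimv_vertex _ dr) addnC addnS.
Qed.

Lemma vertex_sub : (V <= U')%VS.
Proof.
apply: subv_trans (addvSl _ _); apply/subvP => x; rewrite !mem_coneE memv0.
by case/andP => /eqP-> ->; rewrite mem0v.
Qed.

Lemma vertex_scalev c v : v \in V -> scalev c v \in V.
Proof.
by apply: cone_stable => x; rewrite !memv0 => /eqP->; rewrite linear0.
Qed.

(** Compare the multiples of [y] in [u] and [scalev c u] by the last coordinate. If that of [u] is
    nonzero, c is a quotient in F_q; otherwise [first u] is a nonzero vector of [U1] and
    [scattered_point] applies. *)
Lemma affine_cone_scattered c u :
  u \in U' -> u \notin V -> scalev c u \in U' -> exists k : F, c = k%:A.
Proof.
case/memv_addP => v vC [_ /vlineP[l ->] uE] uV.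
case/memv_addP => v' v'C [_ /vlineP[l' ->] cuE].
move: (vC) (v'C); rewrite !mem_coneE => /andP[v1 /eqP v0] /andP[v'1 /eqP v'0].
have cl : c * (l *: y ord_max) = l' *: y ord_max.
  have /ffunP/(_ ord_max) := cuE; rewrite uE !ffunE v0 v'0 !add0r.
  by move=> ->.
have [l0|l0] := eqVneq l 0; last first.
  exists (l' / l); apply: (mulIf y_affine); rewrite mulr_algl.
  by rewrite [l' / l]mulrC -scalerA -cl scalerAr scalerA mulVf // scale1r.
have {}l'0 : l' = 0.
  move/eqP: cl; rewrite l0 scale0r mulr0 eq_sym scaler_eq0 (negPf y_affine) orbF.
  by move/eqP.
move: uE cuE; rewrite l0 l'0 !scale0r !addr0 => uE cuE.
apply: (scattered_point scU.1 hd v1).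
  by apply: contraNneq uV => v10; rewrite uE mem_coneE v10 mem0v v0 eqxx.
rewrite (_ : scalev _ _ = first v') // -cuE uE.
by apply/ffunP => i; rewrite !ffunE.
Qed.

Lemma card_affine_cone_cap (pi : {vspace vecL L r.+1}) k e :
    \dim (V :&: resF pi) = (n * k)%N -> \dim (U' :&: resF pi) = (n * k + e)%N ->
  (B `&` [set P | (P <= pi)%VS]
     #= `I_(q ^ (n * k) * gauss q e + gauss (q ^ n) k))%card.
Proof.
apply: card_linset_cap; first exact: vertex_sub.
  exact: vertex_scalev.
exact: affine_cone_scattered.
Qed.

Lemma card_affine_cone :
  (B #= `I_(q ^ (n * (r - d)) * gauss q (N + 1) + gauss (q ^ n) (r - d)))%card.
Proof.
have resFf : resF (fullv : {vspace vecL L r.+1}) = fullv.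
  by apply/vspaceP => x; rewrite mem_resF !memvf.
have := @card_affine_cone_cap fullv (r - d) (N + 1).
rewrite resFf !capvf dimv_vertex // dimv_affine_cone addn1.
move=> /(_ erefl erefl); congr (_ #= _)%card.
by apply/seteqP; split => [P []//|P BP]; split => //=; exact: subvf.
Qed.

Lemma dotf_img_vertex b v : v \in V -> dot b v != 0 -> (dotf b @: V)%VS = fullv.
Proof.
move=> vV bv0; apply/vspaceP => t; rewrite memvf; apply/memv_imgP.
exists (scalev (t / dot b v) v); first exact: vertex_scalev.
by rewrite dotfE dot_scalev divfK.
Qed.

(** The image of [V], hence of [U'], is all of F_{q^n}, so both lose exactly n dimensions. *)
Lemma card_cap_off_vertex b v : v \in V -> dot b v != 0 ->
  (B `&` [set P | (P <= orth b)%VS]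
     #= `I_(q ^ (n * (r - d - 1)) * gauss q (N + 1)
            + gauss (q ^ n) (r - d - 1)))%card.
Proof.
move=> vV bv0; have bV := dotf_img_vertex vV bv0.
have bU : (dotf b @: U')%VS = fullv.
  by apply/eqP; rewrite eqEsubv subvf -bV limgS ?vertex_sub.
have rd : (r - d = (r - d - 1).+1)%N by rewrite subn1 prednK // subn_gt0.
move: rd; set k := (r - d - 1)%N => rd; apply: card_affine_cone_cap.
  have := dimv_cap_orth V b; rewrite bV dimv_vertex // rd mulnS addnC.
  by move/addnI.
have := dimv_cap_orth U' b; rewrite bU dimv_affine_cone rd mulnS addnC.
by rewrite -addnA => /addnI->; rewrite addn1.
Qed.

Section ContainingVertex.
Variable b : vecF L r.+1.
Hypothesis bV : forall v, v \in V -> dot b v = 0.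

Lemma dot_cone (x : vecF L r.+1) : x ord_max = 0 -> dot b x = dot (first b) (first x).
Proof.
move=> x0; rewrite -(dot_padzero dr) -[x in LHS](subrK (padzero r (first x))).
rewrite linearD /= bV ?add0r // mem_coneE linearB /= padzeroK // subrr mem0v.
by rewrite !ffunE x0 insubN ?subrr ?eqxx //= -leqNgt ltnW.
Qed.

Lemma dotf_img_affine_cone :
  (dotf b @: U' = dotf (first b) @: U1 + <[dot b y]>)%VS.
Proof.
rewrite limgD limg_line dotfE; congr (_ + _)%VS.
apply/vspaceP => t; apply/memv_imgP/memv_imgP => [[x]|[z zU ->]].
  rewrite mem_coneE => /andP[xU /eqP x0] ->; exists (first x) => //.
  by rewrite !dotfE dot_cone.
exists (padzero r z); first by rewrite mem_coneE padzeroK // zU padzero_last /=.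
by rewrite !dotfE dot_padzero.
Qed.

(** The left side without [e] is the dimension of the image of [U'], so [e] is what the kernel has
    beyond the vertex. *)
Lemma card_cap_vertex e :
    (\dim (dotf (first b) @: U1) + (dot b y \notin (dotf (first b) @: U1)%VS) + e
       = N.+1)%N ->
  (B `&` [set P | (P <= orth b)%VS]
     #= `I_(q ^ (n * (r - d)) * gauss q e + gauss (q ^ n) (r - d)))%card.
Proof.
move=> eE; apply: card_affine_cone_cap.
  have := dimv_cap_orth V b.
  have -> : (dotf b @: V = 0)%VS.
    apply/eqP; rewrite -subv0; apply/subvP => _ /memv_imgP[v vV ->].
    by rewrite dotfE bV ?mem0v.
  by rewrite dimv0 addn0 dimv_vertex.
have := dimv_cap_orth U' b; rewrite dimv_affine_cone -eE dotf_img_affine_cone.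
have -> : \dim (dotf (first b) @: U1 + <[dot b y]>) =
    (\dim (dotf (first b) @: U1)
       + (dot b y \notin (dotf (first b) @: U1)%VS))%N.
  case: (boolP (_ \in _)) => by_; last by rewrite dimv_add_line ?addn1.
  by rewrite (addv_idPl _) ?addn0 // -memvE.
by rewrite [(_ + e)%N]addnC [X in _ = X -> _]addnA => /addIn.
Qed.

(** Here [b] vanishes at infinity, and together with [y] the hyperplane at infinity spans
    everything. *)
Lemma dot_affine_neq0 : b != 0 -> first b = 0 -> dot b y != 0.
Proof.
move=> b0 fb0; apply/eqP => by0; have [x] := dot_surj 1 b0.
apply/eqP; rewrite eq_sym.
pose c := x ord_max / y ord_max.
rewrite -[x](subrK (scalev c y)) linearD /= dot_scalev by0 mulr0 addr0.
rewrite dot_cone; last by rewrite !ffunE divfK ?subrr.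
by rewrite fb0 dotC linear0 oner_eq0.
Qed.

End ContainingVertex.

Lemma exists_orth (a : vecF L d) t : exists b : vecF L r.+1,
  [/\ first b = a, dot b y = t & forall v, v \in V -> dot b v = 0].
Proof.
pose e : vecF L r.+1 := [ffun i => (i == ord_max)%:R].
have dote x : dot e x = x ord_max.
  rewrite /dot (bigD1 ord_max) //= big1 => [|i /negPf ni]; rewrite ffunE ?ni ?mul0r //.
  by rewrite eqxx mul1r addr0.
(* The last coefficient of [b] is free; it is solved from [dot b y = t], as [y] is affine. *)
pose s := (t - dot a (first y)) / y ord_max.
pose b := padzero r a + scalev s e.
have dotb x : dot b x = dot a (first x) + s * x ord_max.
  rewrite dotC linearD /= dot_padzero // dot_scalev -dote; congr (_ + _ * _).
    exact: dotC.
  exact: dotC.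
exists b; split=> [||v].
- rewrite linearD /= padzeroK //; apply/ffunP => i; rewrite !ffunE.
  rewrite (_ : _ == _ = false) ?mulr0 ?addr0 //.
  apply/negbTE; rewrite -val_eqE /= inordK.
    by rewrite neq_ltn (ltn_trans (ltn_ord i) dr).
  by rewrite (ltn_trans (ltn_ord i)) // ltnW.
- by rewrite dotb divfK // addrC subrK.
rewrite mem_coneE memv0 dotb => /andP[/eqP-> /eqP->].
by rewrite linear0 mulr0 addr0.
Qed.

End ConeOverScattered.

(** * The set of sizes of hyperplane sections *)

Local Open Scope classical_set_scope.
Local Open Scope card_scope.

Theorem theorem4p5
  (F : finFieldType) (L : fieldExtType F) (q n : nat)
  (hq : #|F| = q) (hn : \dim {:L} = n)
  (r d h : nat) (hr : (2 <= r)%N) (hd : (1 <= d <= r - 1)%N)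
  (hh : (1 <= h <= d - 1)%N) (hdvd : (h.+1 %| d * n)%N)
  (U1 : {vspace vecF L d}) (hU1 : prop_max_scattered h U1)
  (y : vecF L r.+1)
  (hy : ~~ (<[y : vecL L r.+1]> <= pi_infty L r)%VS) :
  let N := (d * n %/ h.+1)%N in
  let U' := (cone r U1 + <[y]>)%VS in
  let B := linset U' in
  let gamma (i : nat) := (N - n + i)%N in
  let beta (i j : nat) :=
    (if (j == 0) && (1 <= i) then 0 else q ^ gamma i)%N in
  B #= `I_(q ^ (n * (r - d)) * gauss q (N + 1) + gauss (q ^ n) (r - d))%N
  /\
  [set s : nat | exists pi : {vspace vecL L r.+1},
      \dim pi = r /\ (B `&` [set P | (P <= pi)%VS]) #= `I_s]
  = [set (q ^ (n * (r - d)) * gauss q N + gauss (q ^ n) (r - d))%N;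
         (q ^ (n * (r - d - 1)) * gauss q (N + 1)
          + gauss (q ^ n) (r - d - 1))%N]
    `|` [set s : nat | exists i j : nat, [/\ (i <= h)%N, (j <= 1)%N &
          s = (q ^ (n * (r - d)) * (gauss q (gamma i) + beta i j)
               + gauss (q ^ n) (r - d))%N]].
Proof.
subst q n; move=> N U' B gamma beta.
have dr : (d < r)%N by move: hr hd; lia.
have hd' : (0 < h < d)%N by move: hd hh; lia.
have hd1 : (h < d)%N by case/andP: hd'.
have y0 : y ord_max != 0 by move: hy; rewrite -memvE mem_pi_infty.
have NE : N = \dim U1 by rewrite /N -hU1.2 mulnK.
have nN : (\dim {:L}%VS <= N)%N by rewrite NE; exact: leq_scattered hd1 hU1.
have hltn : (h < \dim {:L}%VS)%N by exact: ltn_scattered hd1 hU1.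
have q1 : (1 < #|F|)%N by exact: finNzRing_gt1.
have uniq_card (A : set {vspace vecL L r.+1}) s t : A #= `I_s -> A #= `I_t -> s = t.
  by move=> As At; apply/card_eq_II; exact: card_eq_trans (card_esym As) At.
have off b v : v \in cone r (0 : {vspace vecF L d}) -> dot b v != 0 ->
    B `&` [set P | (P <= orth b)%VS]
      #= `I_(#|F| ^ (\dim {:L}%VS * (r - d - 1)) * gauss #|F| (N + 1)
             + gauss (#|F| ^ \dim {:L}%VS) (r - d - 1)).
  rewrite NE; exact: (card_cap_off_vertex dr hd' hU1 y0).
have on b e : (forall v, v \in cone r (0 : {vspace vecF L d}) -> dot b v = 0) ->
    (\dim (dotf (firstcoords d b) @: U1)
       + (dot b y \notin (dotf (firstcoords d b) @: U1)%VS) + e = N.+1)%N ->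
    B `&` [set P | (P <= orth b)%VS]
      #= `I_(#|F| ^ (\dim {:L}%VS * (r - d)) * gauss #|F| e
             + gauss (#|F| ^ \dim {:L}%VS) (r - d)).
  by move=> bV eE; apply: (card_cap_vertex dr hd' hU1 y0 bV); rewrite eE NE.
have img0 : (dotf (0 : vecF L d) @: U1 = 0)%VS.
  apply/eqP; rewrite -subv0; apply/subvP => _ /memv_imgP[x _ ->].
  by rewrite dotfE dotC linear0 mem0v.
split; first by rewrite /B NE; exact: (card_affine_cone dr hd' hU1 y0).
apply/seteqP; split=> [s [pi [dpi Bs]]|s].
  have [b b0 piE] : exists2 b, b != 0 & pi = orth b.
    by apply: hyperplane_orth; rewrite dpi.
  rewrite {}piE in dpi Bs.
  have [[v vV bv0]|noV] := pselect (exists2 v,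
      v \in cone r (0 : {vspace vecF L d}) & dot b v != 0).
    by left; right; apply: uniq_card Bs (off b v vV bv0).
  have bV v : v \in cone r (0 : {vspace vecF L d}) -> dot b v = 0.
    by move=> vV; apply/eqP; apply: contraT => bv0; case: noV; exists v.
  (* If the form on the base vanishes, [pi] is the hyperplane at infinity. *)
  have [a0|a0] := eqVneq (firstcoords d b : vecF L d) 0.
    left; left; apply: uniq_card Bs (on b N bV _); rewrite a0 img0 dimv0 memv0.
    by rewrite (dot_affine_neq0 dr y0 bV b0 a0).
  right; set T := (dotf (firstcoords d b) @: U1)%VS in on.
  have geT : (\dim {:L}%VS <= \dim T + h)%N by exact: dimv_dot_ge hU1 _ a0.
  have leT : (\dim T <= \dim {:L}%VS)%N by apply/dimvS/subvf.
  (* The index i is the codimension of [T]. With b(y) in [T] the exponent is [gamma i] plus 1, and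
     [beta i 1] supplies the extra q^(gamma i). *)
  have [byT|byT] := boolP (dot b y \in T).
    exists (\dim {:L}%VS - \dim T)%N, 1; split=> //; first by move: geT; dimlia.
    rewrite /beta /= gaussS //; apply: uniq_card Bs (on b _ bV _).
    by rewrite byT /gamma; move: nN leT; dimlia.
  (* A value b(y) outside [T] forces i >= 1, where [beta i 0] is 0. *)
  have ltT : (\dim T < \dim {:L}%VS)%N.
    rewrite ltn_neqAle leT andbT; apply: contraNneq byT => dT.
    suff -> : T = fullv by exact: memvf.
    by apply/eqP; rewrite eqEdim subvf dT leqnn.
  exists (\dim {:L}%VS - \dim T)%N, 0; split=> //; first by move: geT; dimlia.
  rewrite /beta /= subn_gt0 ltT addn0; apply: uniq_card Bs (on b _ bV _).
  by rewrite byT /gamma; move: nN leT; dimlia.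
have dim_orth (b : vecF L r.+1) : b != 0 -> \dim (orth b) = r.
  by move/dimv_orth => [].
case=> [[->|->]|[i [j [ih j1 ->]]]].
- have [b [fb by1 bV]] := exists_orth dr y0 0 1.
  have b0 : b != 0.
    by apply: contraNneq (oner_neq0 L) => b0; rewrite -by1 b0 dotC linear0.
  exists (orth b); split; first exact: dim_orth.
  by apply: on => //; rewrite fb img0 dimv0 memv0 by1 oner_eq0.
(* As d < r the vertex has a nonzero vector; any form equal to 1 there will do. *)
- have [|v vV v0] := @memv_notin _ _ (cone r (0 : {vspace vecF L d})) 0%VS.
    by rewrite dimv0 dimv_vertex // muln_gt0 subn_gt0 dr; move: hltn; dimlia.
  rewrite memv0 in v0; have [b bv1] := dot_surj 1 v0; rewrite dotC in bv1.
  have bv0 : dot b v != 0 by rewrite bv1 oner_neq0.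
  have b0 : b != 0.
    by apply: contraNneq bv0 => ->; rewrite dotC linear0.
  by exists (orth b); split; [exact: dim_orth | exact: off bv0].
have [|S [_ _ dS]] := @exists_subv_between _ L 0%VS fullv (\dim {:L}%VS - i)%N (subvf _).
  by rewrite dimv0 leq_subr.
have [a aS] : exists a, (dotf a @: U1)%VS = S.
  by apply: (exists_dot_image hd1 hU1) ih; rewrite dS.
have a0 : a != 0.
  by apply/eqP => a0; move: dS; rewrite -aS a0 img0 dimv0; move: hltn ih; dimlia.
(* The image [S] of codimension i and the value t at [y] can be prescribed independently. *)
have key t : exists2 b : vecF L r.+1, b != 0 & forall e,
    (\dim {:L}%VS - i + (t \notin S) + e = N.+1)%N ->
    B `&` [set P | (P <= orth b)%VS]
      #= `I_(#|F| ^ (\dim {:L}%VS * (r - d)) * gauss #|F| e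
             + gauss (#|F| ^ \dim {:L}%VS) (r - d)).
  have [b [fb byt bV]] := exists_orth dr y0 a t; exists b.
    by apply: contraNneq a0 => b0; rewrite -fb b0 linear0.
  by move=> e eE; apply: on => //; rewrite fb byt aS dS.
have [/andP[/eqP j0 i1]|ij] := boolP ((j == 0%N) && (1 <= i)%N).
  have [|t _ tS] := @memv_notin _ L fullv S; first by rewrite dS; move: hltn i1; dimlia.
  have [b b0 bcard] := key t; exists (orth b); split; first exact: dim_orth.
  rewrite /beta j0 i1 addn0; apply: bcard.
  by rewrite tS /gamma; move: nN hltn ih; dimlia.
(* The value 0 lies in [S]; this serves j = 1, and also i = j = 0, where [S] is everything. *)
have [b b0 bcard] := key 0; exists (orth b); split; first exact: dim_orth.
rewrite /beta (negPf ij) gaussS //; apply: bcard.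
by rewrite mem0v /gamma; move: nN hltn ih; dimlia.
Qed.
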